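(* Let $P$ be a finite irreducible stochastic matrix over a set $\Omega$, and let $k\in\Omega$ be a state. Then $k\in\Omega_b$ (that is, $k$ is completely peaking for $\mathcal T_+(P)$) if and only if $k$ is escorted.
   Context: A stochastic matrix over a set $\Omega$ is a function $P:\Omega\times\Omega\to[0,1]$ with $\sum_{j\in\Omega}P_{ij}=1$ for all $i\in\Omega$; elements of $\Omega$ are called states, and $P$ is finite if $\Omega$ is finite. Write $P_{ij}^{(n)}=(P^n)_{ij}$ for integers $n\ge 0$, with $P^{(0)}=I$. $\mathrm{Gr}(P)$ is the directed graph on $\Omega$ with a directed edge $(i,j)$ exactly when $P_{ij}>0$, and $(i,j)\in\mathrm{Gr}(P^n)$ means $P^{(n)}_{ij}>0$. $P$ is irreducible if $\mathrm{Gr}(P)$ is strongly connected. Tensor algebra: for $k\in\Omega$ let $\mathcal H_{P,k}$ be the Hilbert space with orthonormal basis $\{\xi_{m,j,k}: m\ge 0,\ j\in\Omega,\ (j,k)\in\mathrm{Gr}(P^m)\}$, and let $\mathcal H_P=\bigoplus_{k\in\Omega}\mathcal H_{P,k}$. For $n\ge0$ and $(i,j)\in\mathrm{Gr}(P^n)$ let $S_{ij}^{(n)}\in B(\mathcal H_P)$ be the bounded operator given by $$S_{ij}^{(n)}(\xi_{m,j',k})=\begin{cases}\sqrt{\frac{P_{ij}^{(n)}P_{jk}^{(m)}}{P_{ik}^{(n+m)}}}\;\xi_{n+m,i,k}&\text{if }j=j',\\ 0&\text{otherwise.}\end{cases}$$ Then $\mathcal T_+(P)\subseteq B(\mathcal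 H_P)$ is the norm-closed algebra (not necessarily self-adjoint) generated by $\{S_{ij}^{(n)}:(i,j)\in\mathrm{Gr}(P^n),\ n\ge0\}$. Each $\mathcal H_{P,k}$ is a reducing subspace for $\mathcal T_+(P)$. For $\ell\ge1$, $M_\ell(\mathcal T_+(P))\subseteq M_\ell(B(\mathcal H_P))\cong B(\bigoplus_{n=1}^{\ell}\mathcal H_P)$ carries the operator norm, and for $T=[T_{pq}]\in M_\ell(\mathcal T_+(P))$ the matrix of restrictions $[T_{pq}|_{\mathcal H_{P,k}}]\in M_\ell(B(\mathcal H_{P,k}))\cong B(\bigoplus_{n=1}^{\ell}\mathcal H_{P,k})$ likewise carries the operator norm. Completely peaking: a state $k\in\Omega$ is completely peaking for $\mathcal T_+(P)$ if for some $\ell\ge1$ there is $T=[T_{pq}]\in M_\ell(\mathcal T_+(P))$ with $$\|[T_{pq}|_{\mathcal H_{P,k}}]\|>\max_{s\ne k}\|[T_{pq}|_{\mathcal H_{P,s}}]\|.$$ $\Omega_b$ denotes the set of all completely peaking states. Escorted: a state $k\in\Omega$ is escorted if for every $s\in\Omega$ with $P_{ks}>0$ there exists $k'\in\Omega$ with $k'\neq k$ and $P_{k's}>0$. *)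

(* Defs.v *)
From HB Require Import structures.
From mathcomp Require Import all_boot all_order all_algebra.
From mathcomp Require Import complex ring.
From mathcomp Require Import all_classical all_reals.
From mathcomp Require Import ereal topology normedtype sequences esum.

Set Implicit Arguments.
Unset Strict Implicit.
Unset Printing Implicit Defensive.

Import Order.TTheory GRing.Theory Num.Theory.
Import ComplexField.

Local Open Scope classical_set_scope.
Local Open Scope ring_scope.
Local Open Scope complex_scope.

(* Functions into the scalars have codomain [R[i]^o]: the lmodType instance of
   [R[i]] itself is over [R], whereas here the scalars must be complex. *)
Section SquareSummable.
Variables (R : realType) (I : choiceType).
Implicit Types f g : I -> R[i]^o.

Definition sqsum (f : I -> R[i]^o) : \bar R :=
  \esum_(b in [set: I]) (Normc.normc (f b) ^+ 2)%:E.

Definition l2_pred : {pred I -> R[i]^o} := [pred f | `[< (sqsum f < +oo)%E >]].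

Lemma l2_predP f : reflect (sqsum f < +oo)%E (f \in l2_pred).
Proof. by rewrite inE; apply: asboolP. Qed.

Lemma normc_ge0 (z : R[i]) : 0 <= Normc.normc z.
Proof. by case: z => x y; exact: sqrtr_ge0. Qed.

Lemma sqsum_ge0 f : (0 <= sqsum f)%E.
Proof. by apply: esum_ge0 => b _; rewrite lee_fin exprn_ge0 ?normc_ge0. Qed.

Lemma sqsum0 : sqsum 0 = 0%E.
Proof.
rewrite /sqsum esum1// => b _.
by rewrite [X in Normc.normc X](_ : _ = 0)// Normc.normc0 expr0n.
Qed.

Lemma esum_cstZ (c : R) (h : I -> R) : 0 <= c -> (forall b, 0 <= h b) ->
  \esum_(b in [set: I]) (c * h b)%:E
    = (c%:E * \esum_(b in [set: I]) (h b)%:E)%E.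
Proof.
move=> c0 h0.
have le (d : R) (u : I -> R) : 0 <= d -> (forall b, 0 <= u b) ->
    (\esum_(b in [set: I]) (d * u b)%:E
      <= d%:E * \esum_(b in [set: I]) (u b)%:E)%E.
  move=> d0 u0; apply: ge_ereal_sup => _ [A [Af _] <-].
  under eq_fsbigr do rewrite EFinM.
  rewrite -ge0_mule_fsumr; last by move=> b; rewrite lee_fin.
  by apply: lee_wpmul2l; rewrite ?lee_fin//; apply: ereal_sup_ubound; exists A.
apply/le_anti/andP; split; first exact: le.
have [->|cn0] := eqVneq c 0.
  by rewrite mul0e esum1// => b _; rewrite mul0r.
have cp : 0 < c by rewrite lt_def cn0.
rewrite -lee_pdivlMl//.
apply: le_trans (le c^-1 (fun b => c * h b) _ _); rewrite ?invr_ge0//.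
  by apply: le_esum => b _; rewrite mulrA mulVf// mul1r.
by move=> b; rewrite mulr_ge0.
Qed.

Lemma sqsumZD (a : R[i]) f g :
  (sqsum (a *: f + g)%R
   <= (2 * Normc.normc a ^+ 2)%:E * sqsum f + 2%:E * sqsum g)%E.
Proof.
rewrite /sqsum -!esum_cstZ ?mulr_ge0 ?exprn_ge0 ?normc_ge0//; last 2 first.
- by move=> b; rewrite exprn_ge0 ?normc_ge0.
- by move=> b; rewrite exprn_ge0 ?normc_ge0.
rewrite -esumD; last 2 first.
- by move=> b _; rewrite lee_fin !mulr_ge0 ?exprn_ge0 ?normc_ge0.
- by move=> b _; rewrite lee_fin !mulr_ge0 ?exprn_ge0 ?normc_ge0.
apply: le_esum => b _; rewrite -EFinD lee_fin.
have -> : (a *: f + g) b = a * f b + g b by [].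
apply: (@le_trans _ _
  ((Normc.normc a * Normc.normc (f b) + Normc.normc (g b)) ^+ 2)).
  rewrite lerXn2r ?nnegrE ?addr_ge0 ?mulr_ge0 ?normc_ge0//.
  by rewrite -Normc.normcM le_normcD.
set x := Normc.normc a; set y := Normc.normc (f b); set z := Normc.normc (g b).
rewrite -subr_ge0.
suff -> : 2 * x ^+ 2 * y ^+ 2 + 2 * z ^+ 2 - (x * y + z) ^+ 2
  = (x * y - z) ^+ 2 by exact: sqr_ge0.
ring.
Qed.

Lemma l2_submod_closed : submod_closed l2_pred.
Proof.
split=> [|a f g /l2_predP ff /l2_predP fg]; first by apply/l2_predP; rewrite sqsum0.
apply/l2_predP; apply: le_lt_trans (sqsumZD a f g) _.
by rewrite lte_add_pinfty// lte_mul_pinfty// ?lee_fin ?mulr_ge0 ?exprn_ge0 ?normc_ge0.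
Qed.

HB.instance Definition _ :=
  GRing.isSubmodClosed.Build R[i] (I -> R[i]^o) l2_pred l2_submod_closed.

(* The complex Hilbert space l^2(I), in which [I] indexes the standard
   orthonormal basis. *)
Record l2 := L2 { l2_val :> I -> R[i]^o; l2_valP : l2_val \in l2_pred }.
HB.instance Definition _ := [isSub for l2_val].
HB.instance Definition _ := gen_eqMixin l2.
HB.instance Definition _ := gen_choiceMixin l2.
HB.instance Definition _ := [SubChoice_isSubLmodule of l2 by <:].

Definition l2norm (x : l2) : R := Num.sqrt (fine (sqsum x)).

Lemma l2_delta_subproof (b : I) :
  (fun c => (c == b)%:R : R[i]^o) \in l2_pred.
Proof.
apply/l2_predP; rewrite /sqsum (_ : \esum_(_ in _) _ = 1%E) ?ltry//.
transitivity (\esum_(c in [set b]) (1%:E : \bar R)); last by rewrite esum_set1.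
rewrite [RHS]esum_mkcond; apply: eq_esum => c _.
have [->|cb] := eqVneq c b.
  by rewrite mem_set// Normc.normc1 expr1n.
by rewrite memNset ?Normc.normc0 ?expr0n//; apply/eqP.
Qed.

Definition l2_delta (b : I) : l2 := L2 (l2_delta_subproof b).

End SquareSummable.

Section Operators.
Variables (R : realType) (I : choiceType).
Local Notation H := (l2 R I).
Implicit Types (T : H -> H).

Definition bounded_op T : Prop :=
  linear T /\ exists M : R, forall x, l2norm (T x) <= M * l2norm x.

Definition opnorm T : R := sup [set l2norm (T x) | x in [set x | l2norm x <= 1]].

Definition norm_closed_subalgebra (A : set (H -> H)) : Prop :=
  [/\ A `<=` bounded_op,
      forall (a : R[i]) S T, A S -> A T -> A (a *: S + T),
      forall S T, A S -> A T -> A (S \o T) &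
      forall T, bounded_op T ->
        (forall e : R, 0 < e -> exists2 S, A S & opnorm (T - S) < e) -> A T].

Definition norm_closed_algebra_generated (G : set (H -> H)) : set (H -> H) :=
  smallest norm_closed_subalgebra G.

(* An l-by-l matrix of operators acts on the l-fold Hilbert direct sum of [H];
   [mxop_norm V T] is the operator norm of the matrix of restrictions of the
   entries of [T] to the subspace [V], i.e. of the restriction of [T] to the
   l-fold direct sum of [V]. *)
Definition dsum_norm (l : nat) (x : 'I_l -> H) : R :=
  Num.sqrt (\sum_(p < l) l2norm (x p) ^+ 2).

Definition mxop_apply (l : nat) (T : 'M[H -> H]_l) (x : 'I_l -> H) : 'I_l -> H :=
  fun p => \sum_(q < l) T p q (x q).

Definition mxop_norm (V : set H) (l : nat) (T : 'M[H -> H]_l) : R :=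
  sup [set dsum_norm (mxop_apply T x) |
        x in [set x | (forall q, V (x q)) /\ dsum_norm x <= 1]].

End Operators.

Section StochasticMatrices.
Variables (R : realType) (Omega : finType).
Implicit Types (P : Omega -> Omega -> R) (i j k s : Omega) (m n : nat).

Definition stochastic P : Prop :=
  (forall i j, 0 <= P i j <= 1) /\ (forall i, \sum_j P i j = 1).

Fixpoint stpow P n i j : R :=
  if n is n'.+1 then \sum_l P i l * stpow P n' l j else (i == j)%:R.

Definition Gr P : rel Omega := fun i j => 0 < P i j.

Definition irreducible P : Prop := forall i j, connect (Gr P) i j.

Definition escorted P k : Prop :=
  forall s, 0 < P k s -> exists2 k', k' != k & 0 < P k' s.

(* (m, j, k) indexes the basis vector xi_{m,j,k}. *)
Definition basis_index P : choiceType :=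
  {b : nat * Omega * Omega | Gr (stpow P b.1.1) b.1.2 b.2}.

Definition HP P : lmodType R[i] := l2 R (basis_index P).

(* xi_{m,j,k} if (j,k) is in Gr(P^m); the value 0 otherwise is never used. *)
Definition xi P m j k : HP P :=
  oapp (@l2_delta R (basis_index P)) 0 (insub (m, j, k)).

(* The reducing subspace H_{P,k}, i.e. the closed span of the xi_{m,j,k}. *)
Definition HPk P k : set (HP P) :=
  [set x : HP P | forall b, (val b).2 != k -> (x : l2 R _) b = 0].

(* [T] is the operator S_{ij}^{(n)}: a bounded operator is determined by its
   values on the orthonormal basis. *)
Definition is_S P n i j (T : HP P -> HP P) : Prop :=
  bounded_op T /\
  forall m j' k, Gr (stpow P m) j' k ->
    T (xi P m j' k) =
      if j == j' then
        (Num.sqrt (stpow P n i j * stpow P m j k / stpow P (n + m) i k))%:C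
          *: xi P (n + m) i k
      else 0.

Definition tensor_algebra P : set (HP P -> HP P) :=
  norm_closed_algebra_generated
    [set T | exists n i j, Gr (stpow P n) i j /\ is_S n i j T].

(* The maximum over [s != k] is required to exist: when [k] is the only state
   there is none, and [k] is not completely peaking. *)
Definition completely_peaking P k : Prop :=
  exists l, (0 < l)%N /\ exists T : 'M[HP P -> HP P]_l,
    (forall p q, tensor_algebra (T p q)) /\
    exists s0, [/\ s0 != k,
      forall s, s != k -> mxop_norm (HPk s) T <= mxop_norm (HPk s0) T &
      mxop_norm (HPk s0) T < mxop_norm (@HPk P k) T].

Definition Omega_b P : set Omega := [set k | completely_peaking P k].

End StochasticMatrices.

(* Under stochasticity the operators [is_S] exist: they are the weighted
   shifts [Sop], with all weights at most 1. *)
Section GeneratorsExist.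
Variables (R : realType) (Omega : finType) (P : Omega -> Omega -> R).
Hypothesis sP : stochastic P.

Let n0 : Normc.normc (0 : R[i]^o) = 0 :> R := Normc.normc0 R.
Lemma stpow_ge0 n i j : 0 <= stpow P n i j.
Proof.
elim: n i j => [|n IH] i j /=; first exact: ler0n.
apply: sumr_ge0 => l _; rewrite mulr_ge0//.
by have /andP[] := sP.1 i l.
Qed.

Lemma stpowD n m i k :
  stpow P (n + m) i k = \sum_j stpow P n i j * stpow P m j k.
Proof.
elim: n i => [|n IH] i /=.
  rewrite (bigD1 i)//= eqxx mul1r big1 ?addr0// => j ji.
  by rewrite eq_sym (negbTE ji) mul0r.
under [RHS]eq_bigr do rewrite mulr_suml.
rewrite exchange_big /=; apply: eq_bigr => l _; rewrite IH mulr_sumr.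
by apply: eq_bigr => j _; rewrite mulrA.
Qed.

Lemma stpow_mul_le n m i j k :
  stpow P n i j * stpow P m j k <= stpow P (n + m) i k.
Proof.
rewrite stpowD (bigD1 j)//= lerDl; apply: sumr_ge0 => l _.
by rewrite mulr_ge0 ?stpow_ge0.
Qed.

Variables (n : nat) (i j : Omega).
Hypothesis nij : Gr (stpow P n) i j.

Let wt m k : R := Num.sqrt (stpow P n i j * stpow P m j k / stpow P (n + m) i k).

Lemma wt_le1 m k : 0 <= wt m k <= 1.
Proof.
rewrite sqrtr_ge0/= -[leRHS]sqrtr1 ler_sqrt//.
have := stpow_ge0 (n + m) i k; rewrite le_eqVlt => /orP[/eqP <-|h].
  by rewrite invr0 mulr0.
by rewrite ler_pdivrMr// mul1r stpow_mul_le.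
Qed.

Definition coef (f : basis_index P -> R[i]^o) m j k : R[i] :=
  oapp f 0 (insub (m, j, k)).

Definition Sfun (f : basis_index P -> R[i]^o) : basis_index P -> R[i]^o :=
  fun b => if ((val b).1.2 == i) && (n <= (val b).1.1)%N then
   (wt ((val b).1.1 - n)%N (val b).2)%:C * coef f ((val b).1.1 - n)%N j (val b).2
   else 0.

Lemma Sfun_le f : (sqsum (Sfun f) <= sqsum f)%E.
Proof.
pose D := [set b : basis_index P | [/\ (val b).1.2 = i, (n <= (val b).1.1)%N &
   Gr (stpow P ((val b).1.1 - n)%N) j (val b).2]].
pose sg (b : basis_index P) : basis_index P :=
  insubd b (((val b).1.1 - n)%N, j, (val b).2).
have sgE b : D b -> val (sg b) = (((val b).1.1 - n)%N, j, (val b).2).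
  by move=> [_ _ h]; rewrite /sg val_insubd /= h.
apply: (@le_trans _ _ (\esum_(b in D) (Normc.normc (f (sg b)) ^+ 2)%:E)).
  rewrite [leRHS]esum_mkcond; apply: le_esum => b _.
  rewrite /Sfun; case: ifP => [/andP[/eqP bi nb]|bb]; last first.
    rewrite n0 expr0n/=; case: ifP => // _.
    by rewrite lee_fin exprn_ge0 ?normc_ge0.
  case: ifPn => [|/negP]; rewrite inE => Db.
    rewrite lee_fin lerXn2r ?nnegrE ?normc_ge0// Normc.normcM.
    have -> : coef f ((val b).1.1 - n)%N j (val b).2 = f (sg b).
      by rewrite /coef -(sgE b Db) valK.
    rewrite ler_piMl ?normc_ge0// /Normc.normc/= expr0n/= addr0 sqrtr_sqr.
    by have /andP[h1 h2] := wt_le1 ((val b).1.1 - n)%N (val b).2; rewrite ger0_norm.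
  have -> : coef f ((val b).1.1 - n)%N j (val b).2 = 0.
    rewrite /coef insubN//; apply/negP => h; apply: Db; split => //.
  by rewrite mulr0 Normc.normc0 expr0n.
have inj : {in D &, injective sg}.
  move=> b c; rewrite !inE => Db Dc e; apply: val_inj.
  have := congr1 val e; rewrite (sgE _ Db) (sgE _ Dc).
  case: Db Dc => [+ + _] [+ + _].
  case: (val b) => -[? ?] ?; case: (val c) => -[? ?] ? /= -> h1 -> h2 [e1 ->].
  by rewrite -(subnK h1) e1 subnK.
have bij : set_bij D (sg @` D) sg by split => //; exact/inj_bij.
rewrite -(reindex_esum D (sg @` D) sg (fun b => (Normc.normc (f b) ^+ 2)%:E) bij).
rewrite esum_mkcond; apply: le_esum => b _; case: ifP => // _.
by rewrite lee_fin exprn_ge0 ?normc_ge0.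
Qed.

Lemma Sfun_l2 (x : HP P) : Sfun (x : l2 R _) \in @l2_pred R (basis_index P).
Proof. by apply/l2_predP; apply: le_lt_trans (Sfun_le _) _; apply/l2_predP/l2_valP. Qed.

Definition Sop (x : HP P) : HP P := L2 (Sfun_l2 x).

Lemma xiE m j' k (b : basis_index P) : ((xi P m j' k : l2 R _) b) = (val b == (m, j', k))%:R.
Proof.
rewrite /xi; case: insubP => [c _ <-|h] /=.
  by congr (_%:R); rewrite -val_eqE.
by case: eqP => // e; have := valP b; rewrite [X in is_true X -> _]/= ; move: h; rewrite -e /= => /negP h /h.
Qed.

Lemma Sop_is_S : is_S n i j Sop.
Proof.
split; first split.
- move=> a x y; apply: val_inj; apply: funext => b.
  rewrite -[RHS]/(a * Sfun x b + Sfun y b) -[LHS]/(Sfun (a *: x + y) b).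
  rewrite /Sfun; case: ifP => _; last by rewrite mulr0 addr0.
  rewrite /coef; case: insub => [c|] /=; last by rewrite !mulr0 addr0.
  rewrite -[X in _ * X]/(a * (x : l2 R _) c + (y : l2 R _) c).
  by rewrite mulrDr mulrCA.
- exists 1 => x; rewrite mul1r /l2norm ler_wsqrtr// fine_le//.
  + rewrite ge0_fin_numE ?sqsum_ge0//; apply/l2_predP; exact: l2_valP.
  + rewrite ge0_fin_numE ?sqsum_ge0//; apply/l2_predP; exact: l2_valP.
  + exact: Sfun_le.
move=> m j' k mjk; apply: val_inj; apply: funext => b.
rewrite -[LHS]/(Sfun (xi P m j' k : l2 R _) b) /Sfun.
have coefE m' : coef (xi P m j' k : l2 R _) m' j (val b).2 =
    ((m', j, (val b).2) == (m, j', k))%:R :> R[i].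
  rewrite /coef; case: insubP => [c _ cE|h] /=; first by rewrite xiE cE.
  by case: eqP => // -[e1 e2 e3]; move: h; rewrite e1 e2 e3 mjk.
rewrite coefE.
case: (eqVneq j j') => [jj|jj]; last first.
  by rewrite !xpair_eqE (negbTE jj) andbF/= mulr0; case: ifP.
rewrite -[RHS]/(_ * (xi P (n + m) i k : l2 R _) b) xiE -jj /wt.
case: (val b) => -[N i'] k' /=; rewrite !xpair_eqE eqxx andbT.
have [_|ii] /= := eqVneq i' i; last by rewrite andbF/= mulr0.
rewrite andbT.
case: leqP => /= nN; last first.
  have /negbTE -> : N != (n + m)%N by rewrite neq_ltn (leq_trans nN) ?leq_addr.
  by rewrite mulr0.
rewrite -(eqn_add2l n) subnKC//.
have [eN|] /= := eqVneq N (n + m)%N; last by rewrite !mulr0.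
have [->|] /= := eqVneq k' k; last by rewrite !mulr0.
by rewrite eN addKn.
Qed.
End GeneratorsExist.

(* Main.v *)
Require Import Defs.
From mathcomp Require Import all_boot all_order all_algebra.
From mathcomp Require Import all_classical all_reals.
From mathcomp Require Import complex lra ereal esum.

Set Implicit Arguments.
Unset Strict Implicit.
Unset Printing Implicit Defensive.

Import Order.TTheory GRing.Theory Num.Theory.
Import ComplexField.

Local Open Scope classical_set_scope.
Local Open Scope ring_scope.
Local Open Scope complex_scope.

(** If [k] is not escorted, some state [s] with [P k s > 0] is reached in one
    step from [k] only.  Then [P^(m+1)_(js) = P^(m)_(jk) P_(ks)], so
    [xi_(m,j,k) |-> xi_(m+1,j,s)] is an isometry of [H_k] into [H_s] commuting
    with all generators, hence with [T_+(P)], and [H_s] norms dominate [H_k]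
    norms.  (If [s = k], irreducibility forces [k] to be the only state.)

    If [k] is escorted, let [T] be a column of operators [S^(n_s)_(i_s,k)], one
    for each state [s].  Each of them maps [xi_(0,k,k)] to a unit vector, so [T]
    has norm at least [sqrt |Omega|] on [H_k].  On [H_t] with [t <> k], the
    squared norm of the image of [xi_(m,k,t)] is the sum over [s] of
    [P^(n)_(ik) P^(m)_(kt) / P^(n+m)_(it)], with [m > 0].  For a state [s] with
    [P k s > 0], take [k' <> k] with [P k' s > 0] and choose [i_s = s] and [n_s]
    such that [k] and [k'] are both reached from [s] in [n_s] steps.  Whenever
    the paths from [k] to [t] through [s] carry at least the fraction
    [1/|Omega|] of [P^(m)_(kt)], the paths through [k'] keep the ratio below a
    constant [< 1] independent of [m]. Some [s] always carries that fraction. *)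

Lemma normc_real (R : realType) (r : R) : 0 <= r -> Normc.normc r%:C = r.
Proof. by move=> r0; rewrite /Normc.normc/= expr0n/= addr0 sqrtr_sqr ger0_norm. Qed.

(** * Norm estimates and finite approximation in [l2] *)

Section SquareSummable.
Variables (R : realType) (I : choiceType).
Implicit Types (x y : l2 R I) (a : R[i]) (b : I).

Lemma l2P x y : (forall b, x b = y b) -> x = y.
Proof. by move=> xy; apply: val_inj; apply: funext. Qed.

Lemma l2_ZDE a x y b : (a *: x + y) b = a * x b + y b.
Proof. by []. Qed.

Lemma l2_0E b : (0 : l2 R I) b = 0.
Proof. by []. Qed.

Lemma l2_BE x y b : (x - y) b = x b - y b.
Proof. by []. Qed.

Lemma l2norm_ge0 x : 0 <= l2norm x.
Proof. exact: sqrtr_ge0. Qed.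

Lemma sqsumE x : sqsum x = (l2norm x ^+ 2)%:E.
Proof.
have fx : sqsum x \is a fin_num.
  by rewrite ge0_fin_numE ?sqsum_ge0//; exact/l2_predP/l2_valP.
by rewrite sqr_sqrtr ?fine_ge0 ?sqsum_ge0// fineK.
Qed.

(** The factor 2 stands in for the triangle inequality: what is built on this only shows that
    something is bounded or arbitrarily small. *)
Lemma l2norm_sqrZD_le a x y : l2norm (a *: x + y) ^+ 2 <=
  2 * Normc.normc a ^+ 2 * l2norm x ^+ 2 + 2 * l2norm y ^+ 2.
Proof.
rewrite -lee_fin EFinD (EFinM _ (_ ^+ 2)) (EFinM 2 (l2norm y ^+ 2)) -!sqsumE.
exact: (sqsumZD a (x : I -> R[i]^o) y).
 Qed.

Lemma l2normZ a x : l2norm (a *: x) = Normc.normc a * l2norm x.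
Proof.
apply/eqP; rewrite -(@eqrXn2 _ 2) ?mulr_ge0 ?normc_ge0 ?l2norm_ge0//; apply/eqP.
apply: EFin_inj;
  rewrite exprMn (EFinM (_ a ^+ 2)) -!sqsumE /sqsum -esum_cstZ ?exprn_ge0 ?normc_ge0//.
  by apply: eq_esum => b _; rewrite -exprMn -Normc.normcM.
by move=> b; rewrite exprn_ge0 ?normc_ge0.
Qed.

Lemma normc_le_l2norm x b : Normc.normc (x b) <= l2norm x.
Proof.
rewrite -ler_sqr ?nnegrE ?normc_ge0 ?l2norm_ge0// -lee_fin -sqsumE.
rewrite /sqsum (esumID [set b])/=; last first.
  by move=> c _; rewrite lee_fin exprn_ge0 ?normc_ge0.
rewrite setTI esum_set1 ?lee_fin ?exprn_ge0 ?normc_ge0// leeDl//.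
by apply: esum_ge0 => c _; rewrite lee_fin exprn_ge0 ?normc_ge0.
Qed.

Lemma l2norm_eq0 x : l2norm x = 0 -> x = 0.
Proof.
move=> x0; apply: l2P => b; have := normc_le_l2norm x b; rewrite x0 l2_0E => xb.
by apply: Normc.eq0_normc; apply/le_anti; rewrite xb normc_ge0.
Qed.

Lemma l2norm0 : l2norm (0 : l2 R I) = 0.
Proof. by rewrite -[0 in LHS](scale0r 0) l2normZ Normc.normc0 mul0r. Qed.

Lemma l2norm_delta b : l2norm (l2_delta R b) = 1.
Proof.
rewrite /l2norm /sqsum (_ : \esum_(_ in _) _ = 1%E) ?sqrtr1//.
transitivity (\esum_(c in [set b]) (1%:E : \bar R)); last by rewrite esum_set1.
rewrite [RHS]esum_mkcond; apply: eq_esum => c _ /=.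
have [->|cb] := eqVneq c b; first by rewrite mem_set// Normc.normc1 expr1n.
by rewrite memNset ?Normc.normc0 ?expr0n//; apply/eqP.
Qed.

Lemma l2norm_sqrD_le x y :
  l2norm (x + y) ^+ 2 <= 2 * l2norm x ^+ 2 + 2 * l2norm y ^+ 2.
Proof.
by have := l2norm_sqrZD_le 1 x y; rewrite scale1r Normc.normc1 expr1n mulr1.
Qed.

Lemma l2norm_sqrB_le x y :
  l2norm (x - y) ^+ 2 <= 2 * l2norm x ^+ 2 + 2 * l2norm y ^+ 2.
Proof.
by apply: le_trans (l2norm_sqrD_le _ _) _;
  rewrite -scaleN1r l2normZ normcN Normc.normc1 mul1r.
Qed.

Lemma l2norm_sqr_sum_le (J : Type) (r : seq J) (F : J -> l2 R I) :
  l2norm (\sum_(q <- r) F q) ^+ 2 <= 2 ^+ size r * \sum_(q <- r) l2norm (F q) ^+ 2.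
Proof.
elim: r => [|q r IH]; first by rewrite !big_nil l2norm0 expr0n mulr0.
rewrite !big_cons; apply: le_trans (l2norm_sqrD_le _ _) _.
rewrite /= mulrDr (exprS 2) lerD//; last by rewrite -mulrA ler_wpM2l.
by rewrite ler_wpM2r ?sqr_ge0// ler_peMr// exprn_ege1// ler1n.
Qed.

(** The sum defining [sqsum x] is a supremum over finite sets, so some finite [A] comes within [e]
    of it; cutting [x] off outside [A] leaves exactly the sum over the complement of [A]. *)
Lemma l2_approx x (e : R) : 0 < e -> exists r : seq I,
  l2norm (x - \sum_(b <- r) x b *: l2_delta R b) ^+ 2 < e.
Proof.
move=> e0.
have fx : sqsum x \is a fin_num by rewrite sqsumE.
have [_ [A [fA _] <-] xA] := ub_ereal_sup_adherent e0 fx.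
have nn b : (0 <= (Normc.normc (x b) ^+ 2)%:E)%E.
  by rewrite lee_fin exprn_ge0 ?normc_ge0.
rewrite -esum_fset// in xA; rewrite -[ereal_sup _]/(sqsum x) in xA.
pose s := finmap.enum_fset (fset_set A).
have sE c : (c \in s) = (c \in A) by rewrite -in_fset_set.
have us : uniq s by exact: finmap.fset_uniq.
exists s.
have yE c : (x - \sum_(b <- s) x b *: l2_delta R b) c =
            (if c \in A then 0 else x c).
  rewrite l2_BE.
  have -> (r : seq I) : (\sum_(b <- r) x b *: l2_delta R b) c
      = \sum_(b <- r) x b * (c == b)%:R.
    by elim: r => [|b r IH]; rewrite ?big_nil// !big_cons -IH.
  case: ifPn => cA.
    rewrite (big_rem c) ?sE//= eqxx mulr1 big1_seq ?addr0 ?subrr// => b /andP[_].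
    rewrite mem_rem_uniq // inE => /andP[bc _].
    by rewrite eq_sym (negbTE bc) mulr0.
  rewrite big1_seq ?subr0// => b /andP[_]; rewrite sE => bA.
  by case: eqP => [cb|_]; rewrite ?mulr0//; rewrite cb bA in cA.
rewrite -lte_fin -sqsumE.
have -> : sqsum (x - \sum_(b <- s) x b *: l2_delta R b)
    = \esum_(b in ~` A) (Normc.normc (x b) ^+ 2)%:E.
  rewrite /sqsum [RHS]esum_mkcond; apply: eq_esum => c _.
  rewrite yE in_setC; case: (c \in A); last by [].
  by rewrite Normc.normc0 expr0n.
have := xA; rewrite {1}/sqsum (esumID A [set: I])// !setTI.
have fA' : \esum_(i in A) (Normc.normc (x i) ^+ 2)%:E \is a fin_num.
  rewrite ge0_fin_numE ?esum_ge0//; apply: le_lt_trans (ltry (l2norm x ^+ 2)).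
  rewrite -sqsumE /sqsum esum_mkcond; apply: le_esum => b _.
  by case: ifP => // _; exact: nn.
by rewrite lteBlDr// addeC [X in (_ < X)%E]addeC lteD2rE.
Qed.

End SquareSummable.

Lemma le0_of_le_mul (R : realFieldType) (K z : R) : 0 <= K ->
  (forall e, 0 < e -> z <= K * e) -> z <= 0.
Proof.
move=> K0 zK; rewrite leNgt; apply/negP => z0.
(* The choice [e = z / (K + 1)] makes [K * e] smaller than [z]. *)
have eE : (K + 1) * (z / (K + 1)) = z by rewrite mulrCA divff ?mulr1// gt_eqF ?ltr_wpDl.
have e0 : 0 < z / (K + 1) by rewrite divr_gt0// ltr_wpDl.
by have := zK _ e0; lra.
Qed.

(** * Bounded operators, commutants and norms of operator matrices *)

Section Operators.
Variables (R : realType) (I : choiceType).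
Local Notation H := (l2 R I).
Implicit Types (S T V : H -> H) (x y : H).

Lemma linear_op0 T : linear T -> T 0 = 0.
Proof.
move=> lT; have := lT 1 0 0; rewrite !scale1r addr0 => /(congr1 (fun z => z - T 0)).
by rewrite addrK subrr.
Qed.

Lemma linear_opZ T a x : linear T -> T (a *: x) = a *: T x.
Proof. by move=> lT; have := lT a x 0; rewrite (linear_op0 lT) !addr0. Qed.

Lemma linear_opB T x y : linear T -> T (x - y) = T x - T y.
Proof. by move=> lT; rewrite addrC -scaleN1r lT scaleN1r addrC. Qed.

Lemma linear_op_sum T (J : Type) (r : seq J) (F : J -> H) :
  linear T -> T (\sum_(j <- r) F j) = \sum_(j <- r) T (F j).
Proof.
move=> lT; elim: r => [|j r IH]; first by rewrite !big_nil (linear_op0 lT).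
by rewrite !big_cons -IH -[F j in LHS]scale1r lT scale1r.
Qed.

Lemma bounded_op_sqr T : bounded_op T ->
  exists2 M : R, 0 <= M & forall x, l2norm (T x) ^+ 2 <= M * l2norm x ^+ 2.
Proof.
move=> [_ [M TM]]; exists (M ^+ 2); rewrite ?sqr_ge0// => x.
have Mx : 0 <= M * l2norm x by apply: le_trans (TM x); exact: l2norm_ge0.
by rewrite -exprMn ler_sqr ?nnegrE ?l2norm_ge0.
Qed.

Lemma bounded_op_of_sqr T (M : R) : linear T ->
  (forall x, l2norm (T x) ^+ 2 <= M * l2norm x ^+ 2) -> bounded_op T.
Proof.
move=> lT TM; split=> //; exists (Num.sqrt `|M|) => x.
rewrite -ler_sqr ?nnegrE ?mulr_ge0 ?sqrtr_ge0 ?l2norm_ge0//.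
rewrite exprMn (@sqr_sqrtr _ `|M|)//; apply: le_trans (TM x) _.
by rewrite ler_wpM2r ?sqr_ge0// ler_norm.
Qed.

Lemma bounded_op_ZD (a : R[i]) S T :
  bounded_op S -> bounded_op T -> bounded_op (a *: S + T).
Proof.
move=> bS bT; have [M M0 SM] := bounded_op_sqr bS; have [N N0 TN] := bounded_op_sqr bT.
have aSTE x : (a *: S + T) x = a *: S x + T x by [].
apply: (@bounded_op_of_sqr _ (2 * Normc.normc a ^+ 2 * M + 2 * N)).
  move=> c x y; rewrite !aSTE bS.1 bT.1 !scalerDr !scalerA [a * c]mulrC -!addrA.
  by congr (_ + _); rewrite addrCA.
move=> x; rewrite aSTE; apply: le_trans (l2norm_sqrZD_le _ _ _) _.
rewrite [leRHS]mulrDl; apply: lerD; rewrite -[leRHS]mulrA ler_wpM2l//.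
by rewrite mulr_ge0// sqr_ge0.
Qed.

Lemma bounded_op_comp S T : bounded_op S -> bounded_op T -> bounded_op (S \o T).
Proof.
move=> bS bT; have [M M0 SM] := bounded_op_sqr bS; have [N N0 TN] := bounded_op_sqr bT.
apply: (@bounded_op_of_sqr _ (M * N)) => [c x y|x] /=; first by rewrite bT.1 bS.1.
by apply: le_trans (SM _) _; rewrite -mulrA ler_wpM2l.
Qed.

Lemma bounded_opB S T : bounded_op S -> bounded_op T -> bounded_op (S - T).
Proof. by move=> bS bT; rewrite addrC -scaleN1r; exact: bounded_op_ZD. Qed.

Lemma bounded_op_subalgebra : norm_closed_subalgebra (@bounded_op R I).
Proof. by split=> // *; [exact: bounded_op_ZD|exact: bounded_op_comp]. Qed.

Lemma l2norm_le_opnorm T x : bounded_op T -> l2norm (T x) <= opnorm T * l2norm x.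
Proof.
move=> bT; have [x0|xn0] := eqVneq (l2norm x) 0.
  by rewrite (l2norm_eq0 x0) (linear_op0 bT.1) l2norm0 mulr0.
have xp : 0 < l2norm x by rewrite lt_def xn0 l2norm_ge0.
rewrite -ler_pdivrMr// mulrC.
have -> : (l2norm x)^-1 * l2norm (T x) = l2norm (T ((l2norm x)^-1%:C *: x)).
  by rewrite (linear_opZ _ _ bT.1) l2normZ normc_real ?invr_ge0 ?l2norm_ge0.
apply: ub_le_sup; last first.
  by exists ((l2norm x)^-1%:C *: x) => //=;
    rewrite l2normZ normc_real ?invr_ge0 ?l2norm_ge0// mulVf.
have [M M0 TM] := bounded_op_sqr bT.
exists (Num.sqrt M) => _ [y /= y1 <-].
rewrite -ler_sqr ?nnegrE ?sqrtr_ge0 ?l2norm_ge0// (@sqr_sqrtr _ M)//.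
apply: le_trans (TM y) _; rewrite ler_piMr// expr_le1// l2norm_ge0//.
Qed.

(** Finite combinations of basis vectors are dense: [S - T] kills the approximant [y], so its value
    at [x] is its value at the small vector [x - y]. *)
Lemma bounded_op_ext S T : bounded_op S -> bounded_op T ->
  (forall b, S (l2_delta R b) = T (l2_delta R b)) -> S = T.
Proof.
move=> bS bT ST; apply: funext => x.
apply/eqP; rewrite -subr_eq0; apply/eqP/l2norm_eq0.
have bD := bounded_opB bS bT; have [M M0 DM] := bounded_op_sqr bD.
apply/eqP; rewrite -sqrf_eq0; apply/eqP/le_anti; rewrite sqr_ge0 andbT.
apply: (le0_of_le_mul M0) => e e0.
have [r xr] := l2_approx x e0.
set y := \sum_(b <- r) x b *: l2_delta R b in xr.
have Dy : (S - T) y = 0.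
  rewrite -[LHS]/(S y - T y) (linear_op_sum _ _ bS.1) (linear_op_sum _ _ bT.1).
  apply/eqP; rewrite subr_eq0; apply/eqP; apply: eq_bigr => b _.
  by rewrite (linear_opZ _ _ bS.1) (linear_opZ _ _ bT.1) ST.
have -> : S x - T x = (S - T) (x - y).
  by rewrite (linear_opB _ _ bD.1) Dy subr0.
by apply: le_trans (DM _) _; rewrite ler_wpM2l// ltW.
Qed.

(** Only norm-closedness takes work: for [S] in the commutant and close to [T], the commutator of
    [T] with [V] is that of [T - S], hence small. *)
Lemma commutant_subalgebra V : bounded_op V ->
  norm_closed_subalgebra [set T | bounded_op T /\ forall x, T (V x) = V (T x)].
Proof.
move=> bV; split.
- by move=> T [].
- move=> a S T [bS SV] [bT TV]; split; first exact: bounded_op_ZD.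
  move=> x; have aSTE y : (a *: S + T) y = a *: S y + T y by [].
  by rewrite !aSTE SV TV bV.1.
- move=> S T [bS SV] [bT TV]; split; first exact: bounded_op_comp.
  by move=> x /=; rewrite TV SV.
move=> T bT TA; split=> // x.
have [M M0 VM] := bounded_op_sqr bV.
apply/eqP; rewrite -subr_eq0; apply/eqP/l2norm_eq0.
apply/eqP; rewrite -sqrf_eq0; apply/eqP/le_anti; rewrite sqr_ge0 andbT.
have K0 : 0 <= 4 * M * l2norm x ^+ 2 by rewrite !mulr_ge0// l2norm_ge0.
apply: (le0_of_le_mul K0) => e e0.
have e0' : 0 < Num.sqrt e by rewrite sqrtr_gt0.
have [S [bS SV] TS] := TA _ e0'.
have bD := bounded_opB bT bS.
have De y : l2norm ((T - S) y) ^+ 2 <= e * l2norm y ^+ 2.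
  rewrite -(@sqr_sqrtr _ e (ltW e0)) -[leRHS]exprMn ler_sqr ?nnegrE ?mulr_ge0 ?l2norm_ge0 ?sqrtr_ge0//.
  by apply: le_trans (l2norm_le_opnorm y bD) _; rewrite ler_wpM2r ?l2norm_ge0 ?ltW.
have -> : T (V x) - V (T x) = (T - S) (V x) - V ((T - S) x).
  rewrite -[(T - S) (V x)]/(T (V x) - S (V x)) -[(T - S) x]/(T x - S x).
  by rewrite (linear_opB _ _ bV.1) SV opprB addrA subrK.
apply: le_trans (l2norm_sqrB_le _ _) _.
have h1 : l2norm ((T - S) (V x)) ^+ 2 <= e * (M * l2norm x ^+ 2).
  by apply: le_trans (De _) _; rewrite ler_pM2l.
have h2 : l2norm (V ((T - S) x)) ^+ 2 <= M * (e * l2norm x ^+ 2).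
  by apply: le_trans (VM _) _; rewrite ler_wpM2l.
by lra.
Qed.

Lemma dsum_norm_sqr l (x : 'I_l -> H) :
  dsum_norm x ^+ 2 = \sum_(p < l) l2norm (x p) ^+ 2.
Proof. by rewrite sqr_sqrtr// sumr_ge0// => p _; exact: sqr_ge0. Qed.

Lemma dsum_norm_ge0 l (x : 'I_l -> H) : 0 <= dsum_norm x.
Proof. exact: sqrtr_ge0. Qed.

Lemma l2norm_sqr_le_dsum l (x : 'I_l -> H) q : l2norm (x q) ^+ 2 <= dsum_norm x ^+ 2.
Proof.
by rewrite dsum_norm_sqr (bigD1 q)//= lerDl sumr_ge0// => p _; exact: sqr_ge0.
Qed.

(** A [sup] dominates its elements only if the set is bounded above; the bounds on the finitely many
    entries combine into such a bound. *)
Lemma le_mxop_norm (V : set H) l (T : 'M[H -> H]_l) (x : 'I_l -> H) :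
  (forall p q, bounded_op (T p q)) -> (forall q, V (x q)) -> dsum_norm x <= 1 ->
  dsum_norm (mxop_apply T x) <= mxop_norm V T.
Proof.
move=> bT Vx x1; apply: ub_le_sup; last by exists x.
have [M MT] : {M : 'I_l -> 'I_l -> R |
    forall p q, 0 <= M p q /\ forall x, l2norm (T p q x) ^+ 2 <= M p q * l2norm x ^+ 2}.
  apply: cid.
  have /choice [M hM] : forall pq : 'I_l * 'I_l, exists M : R,
      0 <= M /\ forall x, l2norm (T pq.1 pq.2 x) ^+ 2 <= M * l2norm x ^+ 2.
    by move=> [p q]; have [M ? ?] := bounded_op_sqr (bT p q); exists M.
  by exists (fun p q => M (p, q)) => p q; exact: hM (p, q).
pose C := \sum_(p < l) 2 ^+ size (index_enum 'I_l) * \sum_(q < l) M p q.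
exists (Num.sqrt C) => _ [y /= [_ y1] <-].
rewrite ler_wsqrtr//; apply: ler_sum => p _.
apply: le_trans (l2norm_sqr_sum_le _ _) _; rewrite ler_wpM2l ?exprn_ge0//.
apply: ler_sum => q _; have [M0 TM] := MT p q.
apply: le_trans (TM _) _; rewrite ler_piMr//.
apply: le_trans (l2norm_sqr_le_dsum _ _) _.
by rewrite expr_le1// dsum_norm_ge0.
Qed.

Lemma mxop_norm_le (V : set H) l (T : 'M[H -> H]_l) (c : R) : V 0 ->
  (forall x : 'I_l -> H, (forall q, V (x q)) -> dsum_norm x <= 1 ->
    dsum_norm (mxop_apply T x) <= c) -> mxop_norm V T <= c.
Proof.
move=> V0 Tc; apply: ge_sup => [|_ [x /= [Vx x1] <-]]; last exact: Tc.
(* The supremum must range over a nonempty set; [V 0] puts the zero family in it. *)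
exists (dsum_norm (mxop_apply T (fun=> 0))), (fun=> 0) => //=; split=> //.
by rewrite /dsum_norm big1 ?sqrtr0// => p _; rewrite l2norm0 expr0n.
Qed.

End Operators.

(** * Contractions induced by partial injections of the basis *)

Section Pullback.
Variables (R : realType) (I : choiceType) (g : I -> option I).
Hypothesis g_inj : forall b b' c, g b = Some c -> g b' = Some c -> b = b'.

(** Since [g] is injective where it is defined, the left side is a sum of [h] over a subset of the
    indices. *)
Lemma esum_pullback_le (h : I -> \bar R) : (forall c, 0 <= h c)%E ->
  (\esum_(b in [set: I]) oapp h 0 (g b) <= \esum_(c in [set: I]) h c)%E.
Proof.
move=> h0; pose D := [set b : I | g b].
pose sg b := odflt b (g b).
have inj : {in D &, injective sg}.
  move=> b b'; rewrite !inE /D /sg /=.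
  case E : (g b) => [c|//] _; case E' : (g b') => [c'|//] _ /= cc.
  by rewrite -cc in E'; exact: g_inj E E'.
apply: (@le_trans _ _ (\esum_(b in D) h (sg b))).
  rewrite [leRHS]esum_mkcond; apply: le_esum => b _.
  rewrite /sg; case: ifPn => [_|/negP]; rewrite ?inE /D /=; last by case: (g b).
  by case: (g b) => /=.
rewrite -(reindex_esum D (sg @` D) sg h (inj_bij inj)).
by rewrite esum_mkcond; apply: le_esum => b _; case: ifP.
Qed.

Lemma sqsum_pullback_le (f : I -> R[i]^o) :
  (sqsum (fun b => oapp f 0%R (g b)) <= sqsum f)%E.
Proof.
apply: le_trans (esum_pullback_le _); last first.
  by move=> c; rewrite lee_fin exprn_ge0 ?normc_ge0.
apply: le_esum => b _; case: (g b) => [c|]; rewrite [oapp _ _ _]/= //.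
by rewrite Normc.normc0 expr0n.
Qed.

Lemma pullback_l2 (x : l2 R I) :
  (fun b => oapp (x : I -> R[i]^o) 0 (g b)) \in @l2_pred R I.
Proof.
apply/l2_predP; apply: le_lt_trans (sqsum_pullback_le _) _.
exact/l2_predP/l2_valP.
Qed.

(** A partial isometry: it sends the basis vector at [g b] to the one at [b], and kills the basis
    vectors outside the range of [g]. *)
Definition pullback (x : l2 R I) : l2 R I := L2 (pullback_l2 x).

Lemma l2norm_pullback_le (x : l2 R I) : l2norm (pullback x) <= l2norm x.
Proof.
by rewrite -ler_sqr ?nnegrE ?l2norm_ge0// -lee_fin -!sqsumE sqsum_pullback_le.
Qed.

Lemma bounded_op_pullback : bounded_op pullback.
Proof.
split; last by exists 1 => x; rewrite mul1r l2norm_pullback_le.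
move=> a x y; apply: l2P => b; rewrite l2_ZDE /=.
by case: (g b) => [c|] //=; rewrite mulr0 addr0.
Qed.

End Pullback.

(** * Generators, commutation with the tensor algebra and the reducing subspaces *)

Section TensorAlgebra.
Variables (R : realType) (Omega : finType) (P : Omega -> Omega -> R).
Hypothesis sP : stochastic P.
Implicit Types (x y : HP P) (b c : basis_index P) (i j k s t : Omega) (m n : nat).
Local Notation B := (basis_index P).

Lemma coef_val x b : coef (x : l2 R B) (val b).1.1 (val b).1.2 (val b).2 = (x : l2 R B) b.
Proof. by rewrite /coef -!surjective_pairing valK. Qed.

Lemma coef_notin x m j k : ~~ Gr (stpow P m) j k -> coef (x : l2 R B) m j k = 0.
Proof. by move=> h; rewrite /coef insubN. Qed.

(** Comparing entries through plain triples keeps membership proofs out of the identities between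
    operators below. *)
Lemma coef_ext x y :
  (forall m j k, Gr (stpow P m) j k ->
    coef (x : l2 R B) m j k = coef (y : l2 R B) m j k) -> x = y.
Proof. by move=> xy; apply: l2P => b; rewrite -!coef_val xy ?(valP b). Qed.

Lemma xi_val b : xi P (val b).1.1 (val b).1.2 (val b).2 = l2_delta R b.
Proof. by apply: l2P => c; rewrite xiE -!surjective_pairing val_eqE. Qed.

(** The induction principle for the tensor algebra. A bounded operator is determined on the basis,
    so every generator is some [Sop]. *)
Lemma tensor_algebra_sub (A : set (HP P -> HP P)) : norm_closed_subalgebra A ->
  (forall n i j, Gr (stpow P n) i j -> A (Sop sP n i j)) ->
  @tensor_algebra R Omega P `<=` A.
Proof.
move=> algA SA; apply: smallest_sub => // T [n [i [j [nij [bT TE]]]]].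
suff -> : T = Sop sP n i j by exact: SA.
have [bS SE] := Sop_is_S sP n i j.
apply: bounded_op_ext => // b; rewrite -xi_val.
by rewrite TE ?SE// (valP b).
Qed.

Lemma tensor_algebra_bounded (T : HP P -> HP P) : tensor_algebra T -> bounded_op T.
Proof.
move: T; apply: tensor_algebra_sub => [|n i j _]; first exact: bounded_op_subalgebra.
by have [] := Sop_is_S sP n i j.
Qed.

Lemma tensor_algebra_Sop n i j :
  Gr (stpow P n) i j -> tensor_algebra (Sop sP n i j).
Proof.
move=> nij A [_ GA]; apply: GA; exists n, i, j; split=> //; exact: Sop_is_S.
Qed.

Lemma tensor_algebra0 k : @tensor_algebra R Omega P 0.
Proof.
move=> A [[_ AZD _ _] GA].
(* A closed subalgebra contains 0 only once it has an element [S], as [-S + S]; the state [k]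
   supplies one. *)
have kk : A (Sop sP 0 k k).
  apply: GA; exists 0%N, k, k; split; last exact: Sop_is_S.
  by rewrite /Gr /= eqxx ltr01.
by have := AZD (-1) _ _ kk kk; rewrite scaleN1r addNr.
Qed.

Lemma coef_Sop n i j x m i' k : Gr (stpow P n) i j ->
  coef (Sop sP n i j x : l2 R B) m i' k =
  if (i' == i) && (n <= m)%N then
    (Num.sqrt (stpow P n i j * stpow P (m - n) j k / stpow P (n + (m - n)) i k))%:C
      * coef (x : l2 R B) (m - n)%N j k
  else 0.
Proof.
move=> nij; rewrite {1}/coef; case: insubP => [b _ bE|mk] /=.
  by rewrite /Sfun bE.
(* Off the index set both sides vanish: a path from [j] to [k] of length [m - n] would extend to one
   of length [m] from [i]. *)
case: ifP => // /andP[/eqP ii nm]; rewrite [coef _ _ _ _]coef_notin ?mulr0//.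
apply: contra mk => jk; rewrite /Gr ii -(subnKC nm).
by apply: lt_le_trans (stpow_mul_le sP _ _ _ j _); rewrite mulr_gt0.
Qed.

Lemma tensor_algebra_commute (V : HP P -> HP P) : bounded_op V ->
  (forall n i j x, Gr (stpow P n) i j -> Sop sP n i j (V x) = V (Sop sP n i j x)) ->
  forall T x, tensor_algebra T -> T (V x) = V (T x).
Proof.
move=> bV SV T x TA; have /tensor_algebra_sub sub := commutant_subalgebra bV.
have [n i j nij|_ ->//] := sub _ _ TA.
by split=> [|y]; [have [] := Sop_is_S sP n i j|exact: SV].
Qed.

Definition proj_index k b : option B := if (val b).2 == k then Some b else None.

Lemma proj_index_inj k b b' c :
  proj_index k b = Some c -> proj_index k b' = Some c -> b = b'.
Proof. by rewrite /proj_index; case: ifP => // _; case: ifP => // _ [->] [->]. Qed.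

(** The orthogonal projection onto [HPk k]; commuting with it expresses that this subspace is
    invariant. *)
Definition proj_op k : HP P -> HP P := @pullback R B _ (@proj_index_inj k).

Lemma proj_opP k x : HPk k x <-> proj_op k x = x.
Proof.
split=> [xk|<- b bk].
  apply: l2P => b; rewrite /= /proj_index; case: ifPn => //= bk.
  by rewrite (xk _ bk).
by rewrite /= /proj_index (negbTE bk).
Qed.

Lemma coef_proj_op k x m j t :
  coef (proj_op k x : l2 R B) m j t = if t == k then coef (x : l2 R B) m j t else 0.
Proof.
rewrite /coef; case: insubP => [b _ bE|mk] /=; last by case: ifP.
by rewrite /proj_index bE /=; case: ifP.
Qed.

Lemma Sop_proj_op n i j k x : Gr (stpow P n) i j ->
  Sop sP n i j (proj_op k x) = proj_op k (Sop sP n i j x).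
Proof.
move=> nij; apply: coef_ext => m i' t _; rewrite coef_Sop// !coef_proj_op coef_Sop//.
by case: (t == k) => //; rewrite mulr0; case: ifP.
Qed.

(** * The isometry attached to a state [s] entered only from [k] *)

Section Shift.
Variables k s : Omega.
Hypothesis ks : 0 < P k s.
Hypothesis ksP : forall k', k' != k -> P k' s = 0.

(** The last step of any path into [s] starts at [k]. *)
Lemma stpow_shift m j : stpow P m.+1 j s = stpow P m j k * P k s.
Proof.
rewrite -addn1 stpowD//; have P1 l : stpow P 1 l s = P l s.
  rewrite /= (bigD1 s)//= eqxx mulr1 big1 ?addr0// => l' /negbTE ->.
  by rewrite mulr0.
rewrite (bigD1 k)//= -[X in _ * X + _]/(stpow P 1 k s) P1 big1 ?addr0// => l lk.
by rewrite -[X in _ * X]/(stpow P 1 l s) P1 ksP// mulr0.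
Qed.

Lemma Gr_shift m j : Gr (stpow P m.+1) j s = Gr (stpow P m) j k.
Proof. by rewrite /Gr stpow_shift pmulr_lgt0. Qed.

(** The map runs backwards, from [(m+1, j, s)] to [(m, j, k)], because operators are built as
    pullbacks. *)
Definition shift_index b : option B :=
  if ((val b).2 == s) && (0 < (val b).1.1)%N
  then insub ((val b).1.1.-1, (val b).1.2, k) else None.

Lemma shift_index_inj b b' c :
  shift_index b = Some c -> shift_index b' = Some c -> b = b'.
Proof.
rewrite /shift_index; case: ifP => // /andP[bs b0];
  case: insubP => // _ _ /[swap] [[->]] cE.
case: ifP => // /andP[bs' b0']; case: insubP => // _ _ /[swap] [[->]] cE'.
apply: val_inj; move: cE cE' bs bs' b0 b0'; case: (val b) => -[m j] t.
case: (val b') => -[m' j'] t' /= -> [] + -> /eqP -> /eqP ->.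
by move=> mm m0 m0'; rewrite -(prednK m0) mm prednK.
Qed.

Definition shift_op : HP P -> HP P := pullback shift_index_inj.

Lemma coef_shift_op x m j t : coef (shift_op x : l2 R B) m j t =
  if (t == s) && (0 < m)%N then coef (x : l2 R B) m.-1 j k else 0.
Proof.
rewrite {1}/coef; case: insubP => [b _ bE|mk] /=.
  by rewrite /shift_index bE /=; case: ifP.
case: ifP => // /andP[/eqP ts m0]; rewrite coef_notin//.
by rewrite -Gr_shift prednK// -ts.
Qed.

Lemma Sop_shift_op n i j x : Gr (stpow P n) i j ->
  Sop sP n i j (shift_op x) = shift_op (Sop sP n i j x).
Proof.
move=> nij; apply: coef_ext => m i' t _; rewrite coef_Sop// !coef_shift_op coef_Sop//.
have [->|_] := eqVneq t s; last by rewrite /= mulr0; case: ifP.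
case: (eqVneq i' i) => _ /=; last by case: ifP.
case: m => [|m] /=; first by rewrite sub0n mulr0; case: ifP.
(* In the borderline case [n = m+1] the left side reads the shifted vector at time 0, where it has
   no component. *)
have [nm|mn] := leqP n m; last first.
  case: ifP => // nm; have -> : n = m.+1 by apply/eqP; rewrite eqn_leq nm.
  by rewrite subnn /= mulr0.
(* Numerator and denominator of the weight both gain the factor [P k s], which cancels. *)
rewrite leqW// subSn// addnS !stpow_shift mulrA -mulf_div divff ?mulr1//.
by rewrite gt_eqF.
Qed.

Definition unshift_index b : option B :=
  if (val b).2 == k then insub ((val b).1.1.+1, (val b).1.2, s) else None.

Lemma unshift_index_inj b b' c :
  unshift_index b = Some c -> unshift_index b' = Some c -> b = b'.
Proof.
rewrite /unshift_index; case: ifP => // bk; case: insubP => // _ _ /[swap] [[->]] cE.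
case: ifP => // bk'; case: insubP => // _ _ /[swap] [[->]] cE'.
apply: val_inj; move: cE cE' bk bk'; case: (val b) => -[m j] t.
by case: (val b') => -[m' j'] t' /= -> [] -> -> /eqP -> /eqP ->.
Qed.

(** The shift has a left inverse on [HPk k] given by [unshift_index]; both are pullbacks, hence
    contractions. *)
Lemma l2norm_shift_op x : HPk k x -> l2norm (shift_op x) = l2norm x.
Proof.
move=> xk; apply/le_anti/andP; split; first exact: l2norm_pullback_le.
apply: le_trans (l2norm_pullback_le unshift_index_inj (shift_op x)).
rewrite le_eqVlt; apply/orP; left; apply/eqP; congr l2norm.
apply: l2P => b /=; rewrite /unshift_index; case: ifPn => [/eqP bk|/xk -> //].
case: insubP => [c _ cE|] /=; last by rewrite Gr_shift -bk (valP b).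
by rewrite -[RHS]/((shift_op x : l2 R B) c) -!coef_val coef_shift_op cE /= eqxx bk.
Qed.

Lemma shift_op_HPk x : HPk s (shift_op x).
Proof. by move=> b bs; rewrite -coef_val coef_shift_op (negbTE bs). Qed.

Lemma mxop_norm_shift l (T : 'M[HP P -> HP P]_l) :
  (forall p q, tensor_algebra (T p q)) ->
  mxop_norm (@HPk _ _ P k) T <= mxop_norm (@HPk _ _ P s) T.
Proof.
move=> TA; have bT p q := tensor_algebra_bounded (TA p q).
have bW := @bounded_op_pullback R _ _ shift_index_inj.
have bQ := @bounded_op_pullback R _ _ (@proj_index_inj k).
have Tsh p q x : T p q (shift_op x) = shift_op (T p q x).
  exact: (tensor_algebra_commute bW Sop_shift_op).
have Tpr p q x : T p q (proj_op k x) = proj_op k (T p q x).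
  by apply: (tensor_algebra_commute bQ) => // n i j y; exact: Sop_proj_op.
apply: mxop_norm_le => [b _|x xk x1]; first by [].
suff -> : dsum_norm (mxop_apply T x) = dsum_norm (mxop_apply T (shift_op \o x)).
  apply: le_mxop_norm => //= [q|]; first exact: shift_op_HPk.
  rewrite (_ : dsum_norm _ = dsum_norm x)//.
  by congr Num.sqrt; apply: eq_bigr => q _; rewrite l2norm_shift_op.
congr Num.sqrt; apply: eq_bigr => p _; congr (_ ^+ 2).
rewrite /mxop_apply; under [in RHS]eq_bigr do rewrite Tsh.
rewrite -(linear_op_sum _ _ bW.1) l2norm_shift_op//.
(* The shift is isometric only on [HPk k]; the entries of [T] keep vectors there because they
   commute with the projection. *)
apply/proj_opP; rewrite /proj_op (linear_op_sum _ _ bQ.1); apply: eq_bigr => q _.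
by rewrite -[LHS]Tpr; congr (T p q _); apply/proj_opP.
Qed.

End Shift.

End TensorAlgebra.

(** * Weights of the generators and the two implications *)

Section Peaking.
Variables (R : realType) (Omega : finType) (P : Omega -> Omega -> R).
Hypothesis sP : stochastic P.
Implicit Types (x : HP P) (b c : basis_index P) (i j k s t : Omega) (m n : nat).
Local Notation B := (basis_index P).
Local Notation N := (#|Omega|%:R : R).

(** The square of the coefficient in the definition of [S_{ij}^{(n)}] on [xi_{m,j,k}]. *)
Definition weight n i j m k : R :=
  stpow P n i j * stpow P m j k / stpow P (n + m) i k.

Lemma weight_ge0 n i j m k : 0 <= weight n i j m k.
Proof. by rewrite divr_ge0 ?mulr_ge0 ?stpow_ge0. Qed.

Lemma weight_le1 n i j m k : weight n i j m k <= 1.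
Proof.
have := stpow_ge0 sP (n + m) i k; rewrite le_eqVlt /weight => /orP[/eqP <-|h].
  by rewrite invr0 mulr0.
by rewrite ler_pdivrMr// mul1r stpow_mul_le.
Qed.

(* [Sop sP n i j] reads its value at [b] off at [source_index n i j b]. *)
Definition source_index n i j b : option B :=
  if ((val b).1.2 == i) && (n <= (val b).1.1)%N
  then insub ((val b).1.1 - n, j, (val b).2)%N else None.

Lemma source_index_inj n i j b b' c :
  source_index n i j b = Some c -> source_index n i j b' = Some c -> b = b'.
Proof.
rewrite /source_index; case: ifP => // /andP[bi nb];
  case: insubP => // _ _ /[swap] [[->]] cE.
case: ifP => // /andP[bi' nb']; case: insubP => // _ _ /[swap] [[->]] cE'.
apply: val_inj; move: cE cE' bi bi' nb nb'; case: (val b) => -[m l] t.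
case: (val b') => -[m' l'] t' /= -> [] + -> /eqP -> /eqP ->.
by move=> mm nm nm'; rewrite -(subnK nm) mm subnK.
Qed.

(** The operator sends the [xi_{m,j,k}] to multiples of distinct basis vectors and kills the others,
    so each entry of [x] contributes at most once, scaled by its weight. *)
Lemma l2norm_Sop_le n i j x :
  ((l2norm (Sop sP n i j x) ^+ 2)%:E <= \esum_(c in [set: B])
    (if (val c).1.2 == j
     then weight n i j (val c).1.1 (val c).2 * Normc.normc ((x : l2 R B) c) ^+ 2
     else 0)%:E)%E.
Proof.
rewrite -sqsumE; apply: le_trans (esum_pullback_le (@source_index_inj n i j) _);
  last first.
  by move=> c; rewrite lee_fin; case: ifP => // _;
    rewrite mulr_ge0 ?weight_ge0 ?exprn_ge0 ?normc_ge0.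
apply: le_esum => b _.
rewrite -[(Sop sP n i j x : l2 R B) b]/(Sfun n i j (x : l2 R B) b) /Sfun /source_index.
case: ifP => _; last first.
  by rewrite [oapp _ _ _]/= Normc.normc0 expr0n.
rewrite /coef; case: insubP => [c _ cE|_]; last first.
  by rewrite [X in Normc.normc X]mulr0 [oapp _ _ None in leRHS]/= Normc.normc0 expr0n.
rewrite [oapp _ _ _ in leRHS]/= lee_fin cE eqxx Normc.normcM exprMn.
rewrite normc_real ?sqrtr_ge0//.
by rewrite sqr_sqrtr ?weight_ge0.
Qed.

Lemma stpow1 i j : stpow P 1 i j = P i j.
Proof.
rewrite /= (bigD1 j)//= eqxx mulr1 big1 ?addr0// => l /negbTE ->.
by rewrite mulr0.
Qed.

Lemma stpowD_gt0 n m i j k :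
  0 < stpow P n i j -> 0 < stpow P m j k -> 0 < stpow P (n + m) i k.
Proof.
by move=> nij mjk; apply: lt_le_trans (stpow_mul_le sP _ _ _ j _); rewrite mulr_gt0.
Qed.

Lemma connect_stpow i j : connect (Gr P) i j -> exists n, 0 < stpow P n i j.
Proof.
move=> /connectP[p + ->]; elim: p i => [|l p IH] i /=.
  by move=> _; exists 0%N; rewrite /= eqxx ltr01.
move=> /andP[il /IH[n ln]]; exists (1 + n)%N.
by apply: stpowD_gt0 ln; rewrite stpow1.
Qed.

Lemma common_length k k' s : irreducible P -> 0 < P k s -> 0 < P k' s ->
  exists n, 0 < stpow P n s k /\ 0 < stpow P n s k'.
Proof.
move=> iP; rewrite -!stpow1 => ks k's.
have [a sk] := connect_stpow (iP s k); have [b sk'] := connect_stpow (iP s k').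
(* Reach [k] by the loop from [s] through [k'] and then [a] steps; reach [k'] by the loop through
   [k] and then [b] steps. Both lengths are [a + b + 1]. *)
exists (b + (1 + a))%N; split.
  by apply: stpowD_gt0 sk' _; exact: stpowD_gt0 sk.
rewrite (_ : b + (1 + a) = a + (1 + b))%N;
  last by rewrite addnCA [RHS]addnCA [(b + a)%N]addnC.
by apply: stpowD_gt0 sk _; exact: stpowD_gt0 sk'.
Qed.

(** Pigeonhole: one of the [N] terms summing to [stpow P m.+1 k t] is at least the average. *)
Lemma heavy_successor k m t : exists s, stpow P m.+1 k t <= N * (P k s * stpow P m s t).
Proof.
apply: contrapT => /forallNP h.
have : N * stpow P m.+1 k t < \sum_(s : Omega) stpow P m.+1 k t.
  rewrite mulr_sumr; apply: ltr_sum.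
    by apply/hasP; exists k; rewrite ?mem_index_enum.
  by move=> s _; rewrite ltNge; apply/negP/h.
by rewrite sumr_const mulr_natl ltxx.
Qed.

Lemma card_state_gt0 k : 0 < N.
Proof. by rewrite ltr0n; apply/card_gt0P; exists k. Qed.

(** The generator and the bound are chosen before [m] and [t], so that finitely many choices serve
    the whole subspace. *)
Lemma escorted_weight k s : irreducible P -> escorted P k ->
  exists nir : nat * Omega * R, [/\ 0 < stpow P nir.1.1 nir.1.2 k, nir.2 < 1 &
    forall m t, 0 < stpow P m.+1 k t ->
      stpow P m.+1 k t <= N * (P k s * stpow P m s t) ->
      weight nir.1.1 nir.1.2 k m.+1 t <= nir.2].
Proof.
move=> iP ek; have /andP[ks0 ks1] := sP.1 k s; move: ks0;
  rewrite le_eqVlt => /orP[/eqP ks|ks].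
  (* If [P k s = 0], then [s] never carries the required fraction, and the bound is vacuous. *)
  exists (0%N, k, 0); split=> /=; rewrite ?eqxx ?ltr01// => m t h.
  by rewrite -ks mul0r mulr0 leNgt h.
have [k' k'k k's] := ek _ ks.
have [n [nk nk']] := common_length iP ks k's.
have N0 := card_state_gt0 k.
(* Paths through [s] alone give [stpow P m.+1 k' t] at least [d] times [stpow P m.+1 k t]. Routing
   through [k] and [k'] then makes the denominator of the weight at least [(a + a' * d) * A],
   against the numerator [a * A]. *)
pose d := P k' s / N.
have d0 : 0 < d by rewrite divr_gt0.
pose a := stpow P n s k; pose a' := stpow P n s k'.
have D0 : 0 < a + a' * d by rewrite addr_gt0// mulr_gt0.
exists (n, s, a / (a + a' * d)); split=> //=.
  by rewrite ltr_pdivrMr// mul1r ltrDl mulr_gt0.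
move=> m t A0 hA; rewrite /weight -/a.
set A := stpow P m.+1 k t in A0 hA *.
have hA' : d * A <= stpow P m.+1 k' t.
  apply: (@le_trans _ _ (P k' s * stpow P m s t)).
    rewrite /d -mulrA ler_pM2l// mulrC ler_pdivrMr// mulrC.
    apply: le_trans hA _; rewrite ler_pM2l// ler_piMl ?stpow_ge0//.
  rewrite /= (bigD1 s)//= lerDl sumr_ge0// => l _.
  by rewrite mulr_ge0 ?stpow_ge0//; have /andP[] := sP.1 k' l.
have hD : (a + a' * d) * A <= stpow P (n + m.+1) s t.
  rewrite stpowD// (bigD1 k)// (bigD1 k')// [leRHS]addrA mulrDl.
  apply: ler_wpDr; last by rewrite lerD2l -mulrA ler_pM2l.
  by apply: sumr_ge0 => l _; rewrite mulr_ge0 ?stpow_ge0.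
have Dp : 0 < stpow P (n + m.+1) s t by apply: lt_le_trans hD; rewrite mulr_gt0.
rewrite ler_pdivrMr// [leRHS]mulrAC ler_pdivlMr// -!mulrA ler_pM2l//.
by rewrite mulrC.
Qed.

Lemma l2norm_xi m j k : Gr (stpow P m) j k -> l2norm (xi P m j k) = 1.
Proof. by move=> mjk; rewrite /xi insubT /= l2norm_delta. Qed.

Lemma escorted_peaking k : irreducible P -> escorted P k -> completely_peaking P k.
Proof.
move=> iP ek.
have /choice[f fP] := fun s => escorted_weight s iP ek.
pose rho := \big[Num.max/0]_s (f s).2.
have rho1 : rho < 1.
  rewrite /rho; elim/big_ind: _ => [|u v u1 v1|s _]; first exact: ltr01.
    by rewrite gt_max u1.
  by case: (fP s).
have rhoP s : (f s).2 <= rho by exact: le_bigmax_cond.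
have rho0 : 0 <= rho by exact: bigmax_ge_id.
pose S s : HP P -> HP P := Sop sP (f s).1.1 (f s).1.2 k.
have N0 := card_state_gt0 k.
(* On each basis vector the heavy successor contributes at most [rho], and each of the other [N - 1]
   states at most 1. *)
pose C := N - 1 + rho.
have C0 : 0 <= C by rewrite addr_ge0// subr_ge0 ler1n -(ltr0n R).
have SC s x : s != k -> HPk s x -> \sum_s' l2norm (S s' x) ^+ 2 <= C * l2norm x ^+ 2.
  move=> sk xs.
  rewrite -lee_fin -sumEFin EFinM -sqsumE /sqsum -esum_cstZ//; last first.
    by move=> c; rewrite exprn_ge0 ?normc_ge0.
  apply: le_trans (lee_sum _ (fun s' _ => l2norm_Sop_le _ _ _ _)) _.
  rewrite -esum_sum; last first.
    by move=> c s' _ _; rewrite lee_fin; case: ifP => // _;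
      rewrite mulr_ge0 ?weight_ge0 ?exprn_ge0 ?normc_ge0.
  apply: le_esum => c _; rewrite sumEFin lee_fin.
  have [ck|_] := eqVneq; last by rewrite big1// mulr_ge0 ?exprn_ge0 ?normc_ge0.
  have [cs|/xs ->] := eqVneq (val c).2 s; last first.
    rewrite [Normc.normc _]Normc.normc0 expr0n mulr0 big1// => ? _.
    by rewrite mulr0.
  rewrite -mulr_suml ler_wpM2r ?exprn_ge0 ?normc_ge0//.
  (* Time 0 cannot occur: there is no [xi_{0,k,s}] for [s] different from [k]. *)
  have := valP c; rewrite ck cs; case: (val c).1.1 => [|m mks].
    by rewrite /Gr /= eq_sym (negbTE sk) ltxx.
  have [s0 hs0] := heavy_successor k m s.
  have -> : C = rho + \sum_(s' | s' != s0) 1.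
    rewrite /C (_ : N = \sum_(s' : Omega) 1); last by rewrite sumr_const.
    by rewrite (bigD1 s0)//= [1 + _]addrC addrK addrC.
  rewrite (bigD1 s0)//= lerD//.
    by apply: le_trans (rhoP s0); have [_ _] := fP s0; exact.
  by apply: ler_sum => s' _; exact: weight_le1.
(* One row per state and a single nonzero column; its position [q0] is an arbitrary choice. *)
pose q0 := enum_rank k.
pose T : 'M[HP P -> HP P]_#|Omega| :=
  \matrix_(p, q) if q == q0 then S (enum_val p) else 0.
have Tx (x : 'I_#|Omega| -> HP P) p : mxop_apply T x p = S (enum_val p) (x q0).
  rewrite /mxop_apply (bigD1 q0)//= mxE eqxx big1 ?addr0// => q qq0.
  by rewrite mxE (negbTE qq0).
have TA p q : tensor_algebra (T p q).
  rewrite mxE; case: ifP => _; last exact: (tensor_algebra0 sP k).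
  by apply: tensor_algebra_Sop; case: (fP (enum_val p)).
have upper s : s != k -> mxop_norm (HPk s) T <= Num.sqrt C.
  move=> sk; apply: mxop_norm_le => [b _|x xs x1]; first by [].
  rewrite ler_wsqrtr//; under eq_bigr do rewrite Tx.
  rewrite -(big_enum_val (fun s' => l2norm (S s' (x q0)) ^+ 2)).
  apply: le_trans (SC _ _ sk (xs q0)) _; rewrite ler_piMr//.
  apply: le_trans (l2norm_sqr_le_dsum _ _) _.
  by rewrite expr_le1// dsum_norm_ge0.
have lower : Num.sqrt N <= mxop_norm (@HPk _ _ P k) T.
  have kk : Gr (stpow P 0) k k by rewrite /Gr /= eqxx ltr01.
  (* At time 0 the weight is [stpow P n i k] divided by itself, which is positive by the choice of
     [f]. *)
  have Sxi s : l2norm (S s (xi P 0 k k)) = 1.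
    have [fs _ _] := fP s; have [_ SE] := Sop_is_S sP (f s).1.1 (f s).1.2 k.
    rewrite /S SE// eqxx l2normZ addn0 l2norm_xi// mulr1 normc_real ?sqrtr_ge0//.
    by rewrite /= eqxx mulr1 divff ?sqrtr1// gt_eqF.
  pose x (q : 'I_#|Omega|) : HP P := if q == q0 then xi P 0 k k else 0.
  apply: le_trans (le_mxop_norm (x := x) _ _ _).
  - rewrite ler_wsqrtr//; under eq_bigr do rewrite Tx /x eqxx Sxi expr1n.
    by rewrite sumr_const card_ord.
  - by move=> p q; apply: (tensor_algebra_bounded sP); exact: TA.
  - move=> q b bk; rewrite /x; case: ifP => // _; rewrite xiE.
    by case: eqP => // bE; rewrite bE eqxx in bk.
  - rewrite /dsum_norm (bigD1 q0)//= big1 ?addr0 => [|q qq0].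
      by rewrite /x eqxx l2norm_xi// expr1n sqrtr1.
    by rewrite /x (negbTE qq0) l2norm0 expr0n.
(* The maximum over the other states needs one to exist: row [k] sums to 1, so it has a positive
   entry, whose escort differs from [k]. *)
have [s1 s1k] : exists s1, s1 != k.
  have [s /ek[k' k'k _]] : exists s, 0 < P k s; last by exists k'.
  apply: contrapT => /forallNP h; have := sP.2 k.
  rewrite big1 => [/eqP|s _]; first by rewrite eq_sym oner_eq0.
  apply/le_anti; have /andP[-> _] := sP.1 k s.
  by rewrite andbT leNgt; apply/negP/h.
exists #|Omega|; split; first by rewrite -(ltr0n R).
exists T; split=> //.
case: (@arg_maxP _ R _ s1 (predC1 k) (fun s => mxop_norm (@HPk _ _ P s) T) s1k) => s0 s0k s0P.
exists s0; split=> //.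
apply: le_lt_trans (upper _ s0k) _; apply: lt_le_trans lower.
by rewrite ltr_sqrt// /C; lra.
Qed.

Lemma peaking_escorted k : irreducible P -> completely_peaking P k -> escorted P k.
Proof.
move=> iP [l [l0 [T [TA [s0 [s0k s0max s0lt]]]]]].
apply: contrapT => /existsNP[s /not_implyP[ks nk']].
have ksP k' : k' != k -> P k' s = 0.
  move=> k'k; apply/eqP; rewrite eq_le; have /andP[-> _] := sP.1 k' s.
  by rewrite andbT leNgt; apply/negP => k's; apply: nk'; exists k'.
(* If [s = k], then [k] can be entered only from itself, so it is unreachable from [s0], against
   irreducibility. *)
have [sk|sk] := eqVneq s k.
  have [n] := connect_stpow (iP s0 k); rewrite sk in ks ksP.
  suff -> : stpow P n s0 k = 0 by rewrite ltxx.
  elim: n => [|n IH]; first by rewrite /= (negbTE s0k).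
  by rewrite (stpow_shift ksP) IH mul0r.
have := le_lt_trans (s0max _ sk) s0lt.
by rewrite ltNge (mxop_norm_shift sP ks ksP TA).
Qed.

End Peaking.

Theorem theorem4p2 (R : realType) (Omega : finType) (P : Omega -> Omega -> R)
    (k : Omega) :
  stochastic P -> irreducible P -> (Omega_b P k <-> escorted P k).
Proof.
by move=> sP iP; split; [exact: peaking_escorted|exact: escorted_peaking].
Qed.
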